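(* Let $k\geq 3$ and let $T$ be a $k$-tree equipped with a weighting function $\mathbf{w}: V(T)\cup E(T)\rightarrow \mathbb{C}$. Then: (i) for every $v\in V(T)$, $\mathbf{w}(v)$ is an eigenvalue of the adjacency tensor $\mathcal{A}(T,\mathbf{w})$; (ii) if $\lambda\in\mathbb{C}$ satisfies $\lambda\neq \mathbf{w}(v)$ for every $v\in V(T)$, then $\lambda$ is an eigenvalue of $\mathcal{A}(T,\mathbf{w})$ if and only if there exists a subtree $T'$ of $T$ such that $\lambda$ is a root of $\mu(T',\mathbf{w},x)$ (where $\mathbf{w}$ is restricted to $V(T')\cup E(T')$); (iii) if $\mathbf{w}$ is nonnegative, then the spectral radius of $\mathcal{A}(T,\mathbf{w})$ is equal to the largest root of $\mu(T,\mathbf{w},x)$.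
   Context: A $k$-graph $H$ consists of a finite vertex set $V(H)$ and a set $E(H)$ of $k$-element subsets of $V(H)$ (edges). $E_H(v)$ is the set of edges containing $v$, and $d_H(v)=|E_H(v)|$. A walk is a sequence $v_0e_1v_1\ldots e_\ell v_\ell$ with $v_{i-1},v_i\in e_i$; it is a cycle if no vertices or edges are repeated except $v_0=v_\ell$. $H$ is connected if any two vertices are joined by a walk, and $H$ is a $k$-tree if it is connected and has no cycle. A subtree of a $k$-tree $T$ is a $k$-graph $T'$ with $V(T')\subseteq V(T)$, $E(T')\subseteq E(T)$ which is itself a $k$-tree. For $V(H)=\{v_1,\dots,v_n\}$ and $\mathbf{w}:V(H)\cup E(H)\to\mathbb{C}$, the adjacency tensor $\mathcal{A}(H,\mathbf{w})=(a_{i_1\cdots i_k})$ is the order-$k$, dimension-$n$ tensor with $a_{i\cdots i}=\mathbf{w}(v_i)$, $a_{i_1\cdots i_k}=\mathbf{w}(e)/(k-1)!$ if $\{v_{i_1},\dots,v_{i_k}\}=e\in E(H)$, and $0$ otherwise. For a tensor $\mathcal{A}$ of order $k$ and dimension $n$, $\lambda\in\mathbb{C}$ is an eigenvalue if there is $\mathbf{x}\in\mathbb{C}^n\setminus\{0\}$ with $\mathcal{A}\mathbf{x}^{k-1}=\lambda\mathbf{x}^{[k-1]}$, where $(\mathcal{A}\mathbf{x}^{k-1})_i=\sum_{i_2,\dots,i_k}a_{ii_2\cdots i_k}\mathbf{x}_{i_2}\cdots\mathbf{x}_{i_k}$ and $(\mathbf{x}^{[k-1]})_i=\mathbf{x}_i^{k-1}$;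 the spectral radius is the largest modulus of an eigenvalue. A matching of $H$ is a set of pairwise disjoint edges (the empty set included); $\mathcal{M}(H)$ is the set of matchings and $V(M)$ the set of vertices covered by $M$. The weighted matching polynomial is $\mu(H,\mathbf{w},x)=\sum_{M\in\mathcal{M}(H)}(-1)^{|M|}\prod_{e\in M}\mathbf{w}(e)^k\prod_{v\in V(H)\setminus V(M)}(x-\mathbf{w}(v))$. The weighting $\mathbf{w}$ is nonnegative if $\mathbf{w}(v)\ge 0$ for all vertices and $\mathbf{w}(e)>0$ for all edges. *)

(* Defs.v *)
From HB Require Import structures.
From mathcomp Require Import all_boot all_order all_algebra.
From mathcomp Require Import reals complex.
Set Implicit Arguments.
Unset Strict Implicit.
Unset Printing Implicit Defensive.
Import Order.TTheory GRing.Theory Num.Theory.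
Local Open Scope ring_scope.

(* The vertex set is a subset of an ambient finite type [U], so that a k-graph
   and its sub-k-graphs live in the same type. *)
Record kgraph (k : nat) (U : finType) := KGraph {
  vertices : {set U};
  edges : {set {set U}};
  edge_sub : forall e, e \in edges -> e \subset vertices;
  edge_card : forall e, e \in edges -> #|e| = k
}.

(* The walk v0 e1 v1 ... el vl is given by v0 and p = [:: (e1, v1); ...; (el, vl)]. *)
Fixpoint is_walk (k : nat) (U : finType) (H : kgraph k U) (v0 : U)
    (p : seq ({set U} * U)) : bool :=
  if p is (e, v) :: p' then
    [&& e \in edges H, v0 \in e, v \in e & is_walk H v p']
  else v0 \in vertices H.

Definition walk_end (U : finType) (v0 : U) (p : seq ({set U} * U)) : U :=
  last v0 (unzip2 p).

(* Length 1 is excluded: otherwise v0 e1 v0 would be a cycle for every edge e1.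
   Two distinct edges sharing two vertices do form a cycle, of length 2. *)
Definition is_cycle (k : nat) (U : finType) (H : kgraph k U) (v0 : U)
    (p : seq ({set U} * U)) : bool :=
  [&& is_walk H v0 p, 1 < size p, walk_end v0 p == v0,
      uniq (unzip2 p) & uniq (unzip1 p)]%N.

Definition connected (k : nat) (U : finType) (H : kgraph k U) : Prop :=
  forall u v, u \in vertices H -> v \in vertices H ->
    exists p, is_walk H u p /\ walk_end u p = v.

Definition is_ktree (k : nat) (U : finType) (H : kgraph k U) : Prop :=
  connected H /\ forall v0 p, ~~ is_cycle H v0 p.

Definition is_subtree (k : nat) (U : finType) (T' T : kgraph k U) : Prop :=
  [/\ vertices T' \subset vertices T, edges T' \subset edges T & is_ktree T'].

(* A weighting of H is the restriction of such a map to V(H) and E(H); nothing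
   below depends on its values elsewhere. *)
Definition weighting (U : finType) (K : Type) := (U + {set U})%type -> K.

Definition nonneg_weighting (K : numDomainType) (k : nat) (U : finType)
    (H : kgraph k U) (w : weighting U K) : Prop :=
  (forall v, v \in vertices H -> 0 <= w (inl v)) /\
  (forall e, e \in edges H -> 0 < w (inr e)).

Definition tensor (K : Type) (k n : nat) := k.-tuple 'I_n -> K.

(* The i-th entry of A x^{k-1}: the sum ranges over the multi-indices
   (i_1, ..., i_k) whose first component i_1 is i. *)
Definition tensor_apply (K : pzRingType) (k n : nat) (A : tensor K k n)
    (x : 'cV[K]_n) (i : 'I_n) : K :=
  \sum_(t : k.-tuple 'I_n | ohead t == Some i)
    A t * \prod_(j <- behead t) x j 0.

Definition tensor_eigenvalue (K : pzRingType) (k n : nat) (A : tensor K k n)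
    (lambda : K) : Prop :=
  exists2 x : 'cV[K]_n, x != 0 &
    forall i, tensor_apply A x i = lambda * x i 0 ^+ k.-1.

Definition is_spectral_radius (K : numDomainType) (k n : nat)
    (A : tensor K k n) (rho : K) : Prop :=
  (exists2 lambda, tensor_eigenvalue A lambda & `|lambda| = rho) /\
  (forall lambda, tensor_eigenvalue A lambda -> `|lambda| <= rho).

(* V(H) = {v_1, ..., v_n} is ordered by [enum_val]. *)
Definition adjacency_tensor (K : fieldType) (k : nat) (U : finType)
    (H : kgraph k U) (w : weighting U K) : tensor K k #|vertices H| :=
  fun t =>
    if tval t is i :: s then
      if all (pred1 i) s then w (inl (enum_val i))
      else let e := [set enum_val j | j in tval t] in
           if e \in edges H then w (inr e) / (k.-1)`!%:R else 0
    else 0.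
Arguments adjacency_tensor {K k U} H w _.

Definition is_matching (k : nat) (U : finType) (H : kgraph k U)
    (M : {set {set U}}) : bool :=
  (M \subset edges H) && trivIset M.

Definition matching_poly (K : fieldType) (k : nat) (U : finType)
    (H : kgraph k U) (w : weighting U K) : {poly K} :=
  \sum_(M : {set {set U}} | is_matching H M)
    ((-1) ^+ #|M| * \prod_(e in M) w (inr e) ^+ k) *:
      \prod_(v in vertices H :\: cover M) ('X - (w (inl v))%:P).

(* [rho] is itself a root, and it dominates the modulus of every root; in
   particular it is real, nonnegative and the largest of the real roots. *)
Definition is_largest_root (K : numDomainType) (p : {poly K}) (rho : K) : Prop :=
  root p rho /\ forall z, root p z -> `|z| <= rho.

(* Main.v *)
Require Import Defs.
From HB Require Import structures.
From mathcomp Require Import all_boot all_order all_algebra.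
From mathcomp Require Import ring lra zify.
From mathcomp Require Import reals complex.
Set Implicit Arguments.
Unset Strict Implicit.
Unset Printing Implicit Defensive.
Import Order.TTheory GRing.Theory Num.Theory.
Local Open Scope ring_scope.

(* With [n = k - 1] and [s v = lambda - w v], an eigenvector is a nonzero [x] with
   [s v * x v ^ n = \sum_(e \ni v) w e * \prod_(u in e \ v) x u] for all [v].
   A k-tree is built from one vertex by gluing pendant edges [v |: L]. At a leaf
   [l] the equation reads [s l * x l ^ k = y] with [y = w e * \prod_(u in e) x u],
   and multiplying over [L] gives [y = w e ^ k / (\prod_(l in L) s l) * x v ^ k]
   when [y != 0]. So pruning the edge amounts to replacing [s v] by
   [s v - w e ^ k / \prod_(l in L) s l], and the matching polynomial, as a
   function of [s], obeys exactly the same recursion. Hence a root of [mu] gives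
   an eigenvector, which extends by zero from a subtree to the tree, and a
   nowhere zero eigenvector gives a root of [mu]; the general eigenvector is
   restricted to a component of its support. For nonnegative weights the pruned
   [s v] are real functions of [lambda] that increase at least as fast as
   [lambda] beyond a zero; the zero left when one vertex remains is the Perron
   root, and the triangle inequality rules out eigenvalues of larger modulus. *)

(** * Trees built from pendant edges, and their matching sums *)

(** Here [n] is k - 1. Acyclicity is traded for an induction principle in which the edge glued last
    is pruned first; [V] is never empty. *)
Inductive built (U : finType) (n : nat) : {set U} -> {set {set U}} -> Prop :=
| built_vertex r : built n [set r] set0
| built_pendant (V : {set U}) E v (L : {set U}) :
    built n V E -> v \in V -> [disjoint V & L] -> #|L| = n ->
    built n (L :|: V) ((v |: L) |: E).

(** With [z e = w e ^+ k] and [s v = lambda - w v] this is the value of the matching polynomial at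
    [lambda]. The vertex factors are free parameters because pruning alters them one vertex at a
    time. *)
Definition matching_sum (K : comNzRingType) (U : finType) (V : {set U})
    (E : {set {set U}}) (z : {set U} -> K) (s : U -> K) : K :=
  \sum_(M : {set {set U}} | (M \subset E) && trivIset M)
    (\prod_(e in M) - z e) * \prod_(v in V :\: cover M) s v.

Definition eigenvector_on (K : comNzRingType) (U : finType) (n : nat)
    (V : {set U}) (E : {set {set U}}) (w : {set U} -> K) (s x : U -> K) : Prop :=
  forall v, v \in V ->
    s v * x v ^+ n = \sum_(e in E | v \in e) w e * \prod_(u in e :\ v) x u.

Definition shift_at (K : nmodType) (U : eqType) (s : U -> K) (v : U) (a : K) : U -> K :=
  fun u => if u == v then s u + a else s u.

Section Built.
Variables (U : finType) (n : nat).
Implicit Types (V L : {set U}) (E : {set {set U}}).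

Lemma built_edge_sub V E e : built n V E -> e \in E -> e \subset V.
Proof.
move=> bVE; elim: bVE e => [r|{}V {}E v L _ IH vV _ _] e; first by rewrite inE.
case/setU1P => [->|/IH eV]; last by rewrite subsetU // eV orbT.
by rewrite subUset sub1set inE vV orbT subsetUl.
Qed.

Lemma built_edge_card V E e : built n V E -> e \in E -> #|e| = n.+1.
Proof.
move=> bVE; elim: bVE e => [r|{}V {}E v L _ IH vV dVL cL] e; first by rewrite inE.
case/setU1P => [->|/IH//].
by rewrite cardsU1 cL (disjointFr dVL vV).
Qed.

Lemma pendant_notin V E v L : (0 < n)%N -> built n V E -> v \in V ->
  [disjoint V & L] -> #|L| = n -> v |: L \notin E.
Proof.
move=> n0 bVE vV dVL cL; apply/negP => /(built_edge_sub bVE).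
rewrite subUset => /andP[_ LV].
have /card_gt0P[l lL] : (0 < #|L|)%N by rewrite cL.
by move: (disjointFl dVL lL); rewrite (subsetP LV _ lL).
Qed.

(** Matchings without the new edge leave all of [L] uncovered, whence the factor [S], the product of
    [s] over [L]. Matchings with the new edge correspond to matchings of [E] that miss [v]; merging
    them with these turns the factor [s v] into [s v - z (v |: L) / S]. *)
Lemma matching_sum_pendant (K : fieldType) V E v L (z : {set U} -> K) (s : U -> K) :
  (0 < n)%N -> built n V E -> v \in V -> [disjoint V & L] -> #|L| = n ->
  \prod_(l in L) s l != 0 ->
  matching_sum (L :|: V) ((v |: L) |: E) z s =
  (\prod_(l in L) s l) *
    matching_sum V E z (shift_at s v (- (z (v |: L) / \prod_(l in L) s l))).
Proof.
move=> n0 bVE vV dVL cL s0; set e := v |: L; set s' := shift_at _ _ _.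
have eE : e \notin E by apply: (pendant_notin n0 bVE).
have covE (M : {set {set U}}) : M \subset E -> cover M \subset V.
  move=> /subsetP ME; apply/bigcupsP => f /ME; exact: built_edge_sub.
have dLc (M : {set {set U}}) : M \subset E -> [disjoint L & cover M].
  by move=> /covE cV; rewrite disjoint_sym; apply: disjointWl cV dVL.
have vL : v \notin L by rewrite (disjointFr dVL vV).
rewrite /matching_sum (bigID (fun M : {set {set U}} => e \in M)) /= addrC.
rewrite [X in X + _](eq_bigl (fun M : {set {set U}} => (M \subset E) && trivIset M)); last first.
  move=> M; rewrite andbAC; congr (_ && _).
  apply/andP/idP => [[/subsetP ME eM]|ME].
    apply/subsetP => f fM; move/ME: (fM); rewrite !inE; case/orP => // /eqP fe.
    by rewrite fe (negbTE eM) in fM.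
  split; first by apply: subset_trans ME (subsetUr _ _).
  by apply: contra eE; exact: (subsetP ME).
rewrite [X in _ + X](reindex_onto (fun M => e |: M) (fun M => M :\ e)) /=; last first.
  by move=> M /andP[_ eM]; rewrite setD1K.
(* As [L] is disjoint from [V], adding [e] to a matching of [E] is obstructed only at [v]. *)
rewrite [X in _ + X](eq_bigl (fun M : {set {set U}} => ((M \subset E) && trivIset M) && (v \notin cover M))); last first.
  move=> M; rewrite setU11 andbT.
  have [eM|eM] := boolP (e \in M).
    have -> : (M \subset E) = false.
      by apply/negbTE; apply: contra eE => /subsetP; apply.
    rewrite /= (_ : (e |: M) :\ e == M = false) ?andbF //.
    by apply/eqP => /setP/(_ e); rewrite !inE eqxx eM.
  rewrite setU1K // eqxx andbT.
  rewrite subUset sub1set setU11 /=.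
  rewrite (_ : (M \subset e |: E) = (M \subset E)); last first.
    apply/idP/idP => [/subsetP ME|ME]; last by apply: subset_trans ME (subsetUr _ _).
    apply/subsetP => f fM; move/ME: (fM); rewrite !inE; case/orP => // /eqP fe.
    by rewrite fe (negbTE eM) in fM.
  have [ME|//] /= := boolP (M \subset E).
  apply/idP/andP => [tM|[tM vM]].
    split; first by apply: trivIsetS tM; exact: subsetUr.
    apply/negP => /bigcupP[f fM vf].
    have ef : e != f by apply: contraNneq eM => ->.
    have /trivIsetP/(_ e f) := tM.
    rewrite !inE eqxx fM orbT => /(_ isT isT ef) /disjointFr /(_ (setU11 _ _)).
    by rewrite vf.
  have dM f : f \in M -> [disjoint e & f].
    move=> fM; have fc : f \subset cover M by exact: bigcup_sup.
    apply/pred0P => u /=; rewrite !inE; case: (u =P v) => [->|_] /=.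
      by apply/negbTE; exact: contra (subsetP fc v) vM.
    apply/negbTE/negP => /andP[uL /(subsetP fc)].
    by rewrite (disjointFr (dLc M ME) uL).
  have M0 : set0 \notin M.
    by apply/negP => /(subsetP ME)/(built_edge_card bVE); rewrite cards0.
  by case: (trivIsetU1 dM tM M0).
have prodLV (C : {set U}) : [disjoint L & C] ->
    \prod_(u in (L :|: V) :\: C) s u = (\prod_(l in L) s l) * \prod_(u in V :\: C) s u.
  move=> dLC; rewrite setDUl (setDidPl dLC) (eq_bigl [in [predU L & V :\: C]]) => [|u].
    rewrite bigU //=; apply: disjointWr (subsetDl _ _) _; by rewrite disjoint_sym.
  by rewrite !inE.
(* Matchings covering [v] do not see the shift; each one missing [v] is paired with its extension by
   [e]. *)
rewrite [X in X + _](bigID (fun M : {set {set U}} => v \notin cover M)) /=.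
rewrite [in RHS]mulr_sumr [in RHS](bigID (fun M : {set {set U}} => v \notin cover M)) /=.
rewrite addrAC -big_split /=; congr (_ + _); apply: eq_bigr => M /andP[/andP[ME tM]].
- move=> vM.
  have eM : e \notin M by apply: contra eE; exact: (subsetP ME).
  have vVM : v \in V :\: cover M by rewrite inE vM.
  rewrite big_setU1 //= prodLV ?dLc //.
  have -> : (L :|: V) :\: cover (e |: M) = (V :\: cover M) :\ v.
    rewrite /cover bigcup_setU big_set1; apply/setP => u; rewrite !inE.
    case: (u =P v) => //= _; case: (boolP (u \in L)) => //= uL.
    by rewrite (disjointFl dVL) // andbF.
  rewrite !(big_setD1 v vVM) /= /s' {1}/shift_at eqxx.
  rewrite [X in _ = _ * (_ * (_ * X))](eq_bigr s) => [|u]; last first.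
    by rewrite in_setD1 /shift_at => /andP[/negPf->].
  by field.
- rewrite negbK => vM; rewrite prodLV ?dLc // mulrCA; congr (_ * (_ * _)).
  apply: eq_bigr => u; rewrite inE /s' /shift_at => /andP[uM _].
  by rewrite ifN //; apply: contraNneq uM => ->.
Qed.
End Built.

(** * Eigenvector equations under pruning *)

Section Eig.
Variables (U : finType) (n : nat).
Implicit Types (V L : {set U}) (E : {set {set U}}).

(** All edges of [E] lie in [V], so a leaf sees only the new edge, and this edge meets [V] only in
    [v]. *)
Lemma eigenvector_on_pendant (K : comNzRingType) V E v L (w : {set U} -> K) (s x : U -> K) :
  (0 < n)%N -> built n V E -> v \in V -> [disjoint V & L] -> #|L| = n ->
  eigenvector_on n (L :|: V) ((v |: L) |: E) w s x <->
  (forall l, l \in L ->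
     s l * x l ^+ n = w (v |: L) * (x v * \prod_(u in L :\ l) x u)) /\
  (forall u, u \in V -> s u * x u ^+ n =
     (if u == v then w (v |: L) * \prod_(l in L) x l else 0) +
     \sum_(e in E | u \in e) w e * \prod_(u' in e :\ u) x u').
Proof.
move=> n0 bVE vV dVL cL.
have eE := pendant_notin n0 bVE vV dVL cL.
have vL : v \notin L by rewrite (disjointFr dVL vV).
have sumL l : l \in L -> \sum_(e in (v |: L) |: E | l \in e) w e * \prod_(u in e :\ l) x u =
    w (v |: L) * (x v * \prod_(u in L :\ l) x u).
  move=> lL; rewrite big_mkcondr big_setU1 //= inE lL orbT [X in _ + X]big1 ?addr0 => [|e eE'].
    have lv : l != v by apply: contraNneq vL => <-.
    have vl : v \in (v |: L) :\ l by rewrite !inE eqxx andbT eq_sym.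
    rewrite (big_setD1 v vl) /=.
    congr (_ * (_ * _)); apply: eq_bigl => u; rewrite !inE.
    by case: (u =P v) => [->|//] /=; rewrite (negPf vL) andbF.
  rewrite ifN //; apply: contraL lL => /(subsetP (built_edge_sub bVE eE')) lV.
  by rewrite (disjointFr dVL).
have sumV u : u \in V -> \sum_(e in (v |: L) |: E | u \in e) w e * \prod_(u' in e :\ u) x u' =
    (if u == v then w (v |: L) * \prod_(l in L) x l else 0) +
     \sum_(e in E | u \in e) w e * \prod_(u' in e :\ u) x u'.
  move=> uV; rewrite big_mkcondr big_setU1 //= -big_mkcondr; congr (_ + _).
  rewrite !inE (disjointFr dVL uV) orbF; case: eqP => // ->.
  by rewrite setU1K.
split=> [H|[HL HV] u].
  split=> u uL; have := H u; rewrite inE uL ?orbT => /(_ isT) ->; [exact: sumL|exact: sumV].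
by case/setUP => uu; [rewrite HL ?sumL|rewrite HV ?sumV].
Qed.

(** With [S] and [X] the products of [s] and [x] over [L], multiplying the [n] leaf equations gives
    [S * X ^+ n.+1 = y ^+ n]. Compare with [(a * X) ^+ n.+1 = y ^+ n.+1] and cancel the power of
    [X]. *)
Lemma pendant_elim (K : fieldType) L (a y : K) (s x : U -> K) : (0 < n)%N -> #|L| = n ->
  y != 0 -> (forall l, l \in L -> s l * x l ^+ n.+1 = y) -> a * \prod_(l in L) x l = y ->
  a ^+ n.+1 = (\prod_(l in L) s l) * y.
Proof.
move=> n0 cL y0 H ay; have X0 : \prod_(l in L) x l != 0.
  by apply: contraNneq y0 => X0; rewrite -ay X0 mulr0.
have : (\prod_(l in L) s l) * (\prod_(l in L) x l) ^+ n.+1 = y ^+ n.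
  have -> : y ^+ n = \prod_(l in L) y by rewrite prodr_const cL.
  rewrite -prodrXl -big_split /=; exact: eq_bigr.
move=> H1; apply: (mulIf (expf_neq0 n.+1 X0)).
by rewrite -exprMn ay mulrAC H1 exprSr.
Qed.

(* In the second case the edge [v |: L] carries no weight in the equation at [v],
   so no shift occurs. *)
Lemma eigenvector_on_prune (K : fieldType) V E v L (w : {set U} -> K) (s x : U -> K) :
  (0 < n)%N -> built n V E -> v \in V -> [disjoint V & L] -> #|L| = n ->
  w (v |: L) != 0 -> (forall l, l \in L -> s l != 0) ->
  eigenvector_on n (L :|: V) ((v |: L) |: E) w s x ->
  eigenvector_on n V E w
    (shift_at s v (- (w (v |: L) ^+ n.+1 / \prod_(l in L) s l))) x \/
  ((forall l, l \in L -> x l = 0) /\ eigenvector_on n V E w s x).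
Proof.
move=> n0 bVE vV dVL cL w0 s0 /eigenvector_on_pendant[]// HL HV.
set S := \prod_(l in L) s l.
have S0 : S != 0 by apply/prodf_neq0.
set y := w (v |: L) * x v * \prod_(l in L) x l.
have HL' l : l \in L -> s l * x l ^+ n.+1 = y.
  move=> lL; rewrite exprSr mulrA HL // /y (big_setD1 l lL) /=; ring.
have [y0|y0] := eqVneq y 0; [right|left].
  have xL l : l \in L -> x l = 0.
    move=> lL; apply/eqP; have /eqP := HL' l lL.
    by rewrite y0 mulf_eq0 (negPf (s0 l lL)) expf_eq0 => /andP[].
  split=> // u uV; rewrite HV //; case: eqP => _; last by rewrite add0r.
  have /card_gt0P[l lL] : (0 < #|L|)%N by rewrite cL.
  by rewrite (big_setD1 l lL) /= xL // mul0r mulr0 add0r.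
have yE : (w (v |: L) * x v) ^+ n.+1 = S * y by exact: (pendant_elim n0 cL y0 HL' erefl).
move=> u uV; rewrite /shift_at; have := HV u uV; case: eqP => [-> {u uV}|_ ->]; last by rewrite add0r.
rewrite mulrDl => ->; rewrite addrAC -[RHS]add0r; congr (_ + _); apply/eqP.
have xv : x v != 0 by apply: contraNneq y0 => xv; rewrite /y xv mulr0 mul0r.
(* Multiplied by [x v], the edge term at [v] is [y], which [yE] expresses through [x v ^+ n.+1]. *)
rewrite mulNr subr_eq0; apply/eqP; apply: (mulIf xv).
rewrite -[RHS]mulrA -exprSr [RHS]mulrAC -exprMn yE [RHS]mulrAC divff // mul1r /y; ring.
Qed.

Lemma matching_sum_edgeless (K : comNzRingType) V (z : {set U} -> K) (s : U -> K) :
  matching_sum V set0 z s = \prod_(v in V) s v.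
Proof.
rewrite /matching_sum (big_pred1 set0) => [|M].
  by rewrite big_set0 mul1r /cover big_set0 setD0.
rewrite subset0 /=; case: eqP => //= ->; apply/trivIsetP => A B; by rewrite inE.
Qed.

(** Nonzero entries force [s l != 0] at every leaf, and exclude the outcome of pruning in which [x]
    vanishes on [L]. So [x] stays an eigenvector for the shifted factors down to a single vertex
    [r], where the equation says [s r = 0]. *)
Lemma matching_sum_eq0 (K : fieldType) V E (w : {set U} -> K) (s x : U -> K) :
  (0 < n)%N -> built n V E ->
  (forall e, e \in E -> w e != 0) -> (forall v, v \in V -> x v != 0) ->
  eigenvector_on n V E w s x ->
  matching_sum V E (fun e => w e ^+ n.+1) s = 0.
Proof.
move=> n0 bVE; elim: bVE s => [r|{}V {}E v L bVE IH vV dVL cL] s w0 x0 Hx.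
  rewrite matching_sum_edgeless big_set1; have /eqP := Hx r (set11 r).
  rewrite big1 => [|e]; last by rewrite inE.
  by rewrite mulf_eq0 expf_eq0 (negPf (x0 r (set11 r))) andbF orbF => /eqP.
have [HL _] := (eigenvector_on_pendant w s x n0 bVE vV dVL cL).1 Hx.
have we : w (v |: L) != 0 by apply: w0; rewrite setU11.
have xL u : u \in L -> x u != 0 by move=> uL; rewrite x0 // inE uL.
have s0 l : l \in L -> s l != 0.
  move=> lL; apply: contraTneq isT => sl; have /eqP := HL l lL.
  rewrite sl mul0r eq_sym !mulf_eq0 (negPf we) /= (negPf (x0 _ _)) ?inE ?vV ?orbT //= => Z.
  suff : \prod_(u in L :\ l) x u != 0 by rewrite Z.
  by apply/prodf_neq0 => u /setD1P[_ /xL].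
rewrite (matching_sum_pendant _ n0 bVE vV dVL cL); last by apply/prodf_neq0.
have [Hx'|[xL0 _]] := eigenvector_on_prune n0 bVE vV dVL cL we s0 Hx.
  rewrite IH ?mulr0 // => [e eE|u uV]; first by rewrite w0 // inE eE orbT.
  by rewrite x0 // inE uV orbT.
have /card_gt0P[l lL] : (0 < #|L|)%N by rewrite cL.
by have := xL l lL; rewrite xL0 ?eqxx.
Qed.

(** For an arbitrary choice of roots the product differs from [y] by a root of unity, which is
    absorbed into one of them. This is how eigenvector entries at the leaves are chosen. *)
Lemma kth_roots (K : numClosedFieldType) L (a : U -> K) (g y : K) :
  L != set0 -> g ^+ n.+1 * \prod_(l in L) a l = y ^+ n.+1 ->
  exists c : U -> K, (forall l, l \in L -> c l ^+ n.+1 = a l) /\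
    g * \prod_(l in L) c l = y.
Proof.
move=> /set0Pn[l0 l0L] Hy; pose c0 l := n.+1.-root (a l).
have c0E l : c0 l ^+ n.+1 = a l by rewrite rootCK.
set y0 := g * \prod_(l in L) c0 l.
have y0E : y0 ^+ n.+1 = y ^+ n.+1.
  by rewrite -Hy exprMn -prodrXl; congr (_ * _); apply: eq_bigr.
have [y00|y00] := eqVneq y0 0.
  exists c0; split => //; rewrite -/y0 y00; apply/esym/eqP.
  by have /esym/eqP := y0E; rewrite y00 expr0n expf_eq0.
pose r := y / y0; have r1 : r ^+ n.+1 = 1.
  by rewrite expr_div_n y0E divff // -y0E expf_neq0.
exists (fun l => if l == l0 then r * c0 l else c0 l); split=> [l lL|].
  by case: eqP => // _; rewrite exprMn r1 mul1r.
rewrite (big_setD1 l0 l0L) /= eqxx (eq_bigr c0) => [|l /setD1P[/negPf->]//].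
have -> : y = r * y0 by rewrite divfK.
by rewrite /y0 (big_setD1 l0 l0L) /=; ring.
Qed.

(** An edge has at least three vertices, so every product over [e :\ u] contains a vertex other than
    [v] and vanishes. *)
Lemma indicator_eigenvector (K : comNzRingType) V E (w : {set U} -> K) (s : U -> K) v :
  (1 < n)%N -> (forall e, e \in E -> #|e| = n.+1) -> s v = 0 ->
  eigenvector_on n V E w s (fun u => (u == v)%:R).
Proof.
move=> n1 cE sv u uV.
rewrite [RHS]big1 => [|e /andP[eE ue]]; last first.
  have /card_gt0P[t] : (0 < #|e :\ u :\ v|)%N.
    have := cE e eE; rewrite (cardsD1 u) ue (cardsD1 v (e :\ u)).
    by case: (_ \in _) => /= [[Hn]|[Hn]]; lia.
  rewrite !inE => /andP[tv /andP[tu te]].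
  by rewrite (bigD1 t) ?inE ?tu //= (negPf tv) mul0r mulr0.
case: eqP => [->|_]; first by rewrite sv mul0r.
by rewrite expr0n gtn_eqF ?mulr0 // ltnW.
Qed.

(** The converse of pruning: an eigenvector for the shifted factors on [V] is extended to the leaves
    by suitable roots of [y / s l]. *)
Lemma exists_eigenvector_on (K : numClosedFieldType) V E (w : {set U} -> K) (s : U -> K) :
  (1 < n)%N -> built n V E -> matching_sum V E (fun e => w e ^+ n.+1) s = 0 ->
  exists2 x, eigenvector_on n V E w s x & exists2 v, v \in V & x v != 0.
Proof.
move=> n1 bVE; have n0 := ltnW n1.
elim: bVE s => [r|{}V {}E v L bVE IH vV dVL cL] s.
  rewrite matching_sum_edgeless big_set1 => sr; exists (fun u => (u == r)%:R).
    by apply: indicator_eigenvector => // e; rewrite inE.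
  by exists r; rewrite ?set11 // eqxx oner_eq0.
(* A leaf with [s l = 0] would block the division by the product over [L], but its indicator is
   already an eigenvector. *)
have [/existsP[l /andP[lL /eqP sl]] _|] := boolP [exists l, (l \in L) && (s l == 0)].
  exists (fun u => (u == l)%:R).
    apply: indicator_eigenvector => // e; exact: (built_edge_card (built_pendant bVE vV dVL cL)).
  by exists l; rewrite ?inE ?lL // eqxx oner_eq0.
rewrite negb_exists => /forallP sL.
have {}sL l : l \in L -> s l != 0 by move=> lL; have := sL l; rewrite lL.
set S := \prod_(l in L) s l; have S0 : S != 0 by apply/prodf_neq0.
rewrite (matching_sum_pendant _ n0 bVE vV dVL cL) // => /eqP.
rewrite mulf_eq0 (negPf S0) /= => /eqP /IH[x Hx [u0 u0V xu0]].
set we := w (v |: L); set z := we ^+ n.+1.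
(* The value that the product of all entries on the new edge, times [we], must take according to the
   pruning identity. *)
pose y := z / S * x v ^+ n.+1.
have L0 : L != set0 by rewrite -card_gt0 cL.
have [|c [cE gy]] := @kth_roots _ L (fun l => y / s l) (we * x v) y L0.
  rewrite big_split /= prodr_const cL prodfV exprMn -/z -/S.
  by rewrite [RHS]exprSr [X in _ = _ * X](_ : y = z / S * x v ^+ n.+1) //; ring.
have vL : v \notin L by rewrite (disjointFr dVL vV).
pose x' u := if u \in L then c u else x u.
have xV u : u \in V -> x' u = x u by move=> uV; rewrite /x' (disjointFr dVL uV).
have xL u : u \in L -> x' u = c u by rewrite /x' => ->.
have c0 l : l \in L -> c l = 0 -> y = 0.
  move=> lL cl; have /eqP := cE l lL.
  by rewrite cl expr0n eq_sym mulf_eq0 invr_eq0 (negPf (sL l lL)) orbF => /eqP.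
have y0 l : l \in L -> y = 0 -> c l = 0.
  by move=> lL yy; have /eqP := cE l lL; rewrite yy mul0r expf_eq0 => /andP[_ /eqP].
exists x'; last by exists u0; [rewrite inE u0V orbT | rewrite xV].
apply/(eigenvector_on_pendant _ _ _ n0 bVE vV dVL cL); split=> [l lL|u uV].
  rewrite xL // xV // -/we.
  have -> : \prod_(u in L :\ l) x' u = \prod_(u in L :\ l) c u.
    by apply: eq_bigr => u /setD1P[_ /xL].
  have [cl|cl] := eqVneq (c l) 0.
    (* Since [n > 1] there is another leaf, where [c] vanishes too, so both sides are zero. *)
    have /card_gt0P[t tL] : (0 < #|L :\ l|)%N by have := cardsD1 l L; rewrite cL lL; lia.
    rewrite cl (big_setD1 t tL) /= (y0 t) ?(c0 l) //; last by case/setD1P: tL.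
    by rewrite mul0r !mulr0 expr0n gtn_eqF // mulr0.
  apply: (mulIf cl); rewrite -mulrA -exprSr cE // mulrCA divff ?sL // mulr1 -gy.
  by rewrite (big_setD1 l lL) /=; ring.
rewrite xV // (eq_bigr (fun e => w e * \prod_(t in e :\ u) x t)); last first.
  move=> e /andP[eE _]; congr (_ * _); apply: eq_bigr => t /setD1P[_ te].
  by rewrite xV // (subsetP (built_edge_sub bVE eE)).
rewrite -Hx // /shift_at; case: eqP => [->|_]; last by rewrite add0r.
have -> : \prod_(l in L) x' l = \prod_(l in L) c l by exact: eq_bigr.
rewrite -/we -/z -/S.
suff -> : we * \prod_(l in L) c l = z / S * x v ^+ n by ring.
have [xv|xv] := eqVneq (x v) 0.
  have yy : y = 0 by rewrite /y xv expr0n mulr0.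
  have /card_gt0P[t tL] : (0 < #|L|)%N by rewrite cL.
  by rewrite (big_setD1 t tL) /= y0 // mul0r mulr0 xv expr0n gtn_eqF // mulr0.
by apply: (mulIf xv); rewrite mulrAC gy -[RHS]mulrA -exprSr.
Qed.
End Eig.

(** * Expansive functions and the Perron root *)

(* [t] is a rational function without poles on [a, +oo), vanishing at [a]; being
   rational lets the intermediate value theorem for polynomials apply to it. *)
Definition expansive_from (R : realFieldType) (t : R -> R) (a : R) : Prop :=
  [/\ t a = 0, forall l m, a <= l -> l <= m -> m - l <= t m - t l &
   exists p q : {poly R}, forall l, a <= l -> 0 < q.[l] /\ t l = p.[l] / q.[l]].

Lemma expansive_ge (R : realFieldType) (t : R -> R) a l : expansive_from t a ->
  a <= l -> l - a <= t l.
Proof. by case=> ta ti _ al; have := ti a l (lexx _) al; rewrite ta subr0. Qed.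

Lemma expansive_gt0 (R : realFieldType) (t : R -> R) a l : expansive_from t a ->
  a < l -> 0 < t l.
Proof. by move=> H al; apply: lt_le_trans (expansive_ge H (ltW al)); rewrite subr_gt0. Qed.

(** Let [m] maximize [a] on the edge. Beyond [a m] all factors are nonnegative and increasing, and
    their product grows from 0 past [z]; [c] is where it equals [z]. From [c] on, the subtracted
    quotient decreases, so expansion is inherited from [t v]. *)
Lemma expansive_pendant (R : rcfType) (U : finType) v (L : {set U})
    (t : U -> R -> R) (a : U -> R) (z : R) :
  v \notin L -> 0 < z -> (forall u, u \in v |: L -> expansive_from (t u) (a u)) ->
  exists2 c, (forall u, u \in v |: L -> a u < c) &
    expansive_from (fun l => t v l - z / \prod_(u in L) t u l) c.
Proof.
move=> vL z0 H; set e := v |: L.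
have ve : v \in e by rewrite setU11.
have Le l : l \in L -> l \in e by rewrite in_setU1 orbC => ->.
have [m me am] : exists2 m, m \in e & forall u, u \in e -> a u <= a m.
  by case: (@arg_maxP _ _ _ v (mem e) a ve) => m me am; exists m.
have /fin_all_exists[pq Hpq] : forall u, exists pq : {poly R} * {poly R}, u \in e ->
    forall l, a u <= l -> 0 < pq.2.[l] /\ t u l = pq.1.[l] / pq.2.[l].
  move=> u; have [/H[_ _ [p [q Hp]]]|] := boolP (u \in e); first by exists (p, q).
  by exists (0, 0).
(* Clearing the positive denominators gives a polynomial with the sign of the product of all [t u]
   minus [z]. *)
pose N := (pq v).1 * \prod_(l in L) (pq l).1 - z *: ((pq v).2 * \prod_(l in L) (pq l).2).
have q0 u l : u \in e -> a m <= l -> 0 < (pq u).2.[l].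
  by move=> ue ml; case: (Hpq u ue l) => //; apply: le_trans ml; exact: am.
have tE u l : u \in e -> a m <= l -> (pq u).1.[l] = t u l * (pq u).2.[l].
  move=> ue ml; have [|? ->] := Hpq u ue l; first by apply: le_trans ml; exact: am.
  by rewrite divfK // gt_eqF.
have Q0 l : a m <= l -> 0 < \prod_(u in L) (pq u).2.[l].
  by move=> ml; apply: prodr_gt0 => u uL; apply: q0; rewrite ?Le.
have PE l : a m <= l ->
    \prod_(u in L) (pq u).1.[l] = \prod_(u in L) t u l * \prod_(u in L) (pq u).2.[l].
  by move=> ml; rewrite -big_split; apply: eq_bigr => u uL; rewrite /= tE ?Le.
have NE l : a m <= l -> N.[l] =
    (t v l * \prod_(u in L) t u l - z) * ((pq v).2.[l] * \prod_(u in L) (pq u).2.[l]).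
  move=> ml; rewrite /N !(hornerD, hornerN, hornerZ, hornerM) !horner_prod tE // PE //; ring.
have tm0 : t v (a m) * \prod_(u in L) t u (a m) = 0.
  case/setU1P: (me) (H m me) => [mv [ta _ _]|mL [ta _ _]]; first by rewrite -{1}mv ta mul0r.
  by rewrite (big_setD1 m mL) /= ta mul0r mulr0.
(* At the right end every factor is at least [1 + z], hence so is [t v], while the product over [L]
   is at least 1. *)
have [c /andP[mc cb] /rootP Nc] : exists2 c, a m <= c <= a m + (1 + z) & root N c.
  apply: poly_ivt; first by rewrite lerDl; lra.
  have mb : a m <= a m + (1 + z) by lra.
  have Qv l : a m <= l -> 0 < (pq v).2.[l] * \prod_(u in L) (pq u).2.[l].
    by move=> ml; rewrite mulr_gt0 ?q0 ?Q0.
  apply/andP; split.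
    by rewrite NE // tm0 sub0r mulNr oppr_le0 mulr_ge0 ?ltW // Qv.
  rewrite NE // pmulr_lge0 ?Qv // subr_ge0.
  have tb u : u \in e -> 1 + z <= t u (a m + (1 + z)).
    move=> ue; have aum := am u ue.
    by apply: le_trans (expansive_ge (H u ue) _); lra.
  have T1 : 1 <= \prod_(u in L) t u (a m + (1 + z)).
    apply: (big_ind (fun y => 1 <= y)) => // [y y' y1 y1'|u uL].
      by nra.
    by have := tb u (Le u uL); lra.
  have := tb v ve; nra.
have {}Nc : t v c * \prod_(u in L) t u c = z.
  have /eqP := NE c mc; rewrite Nc eq_sym mulf_eq0 subr_eq0 => /orP[/eqP//|].
  by rewrite gt_eqF // mulr_gt0 ?q0 ?Q0.
(* Strictness makes every factor positive from [c] on, so that the quotient is defined there. *)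
have {}mc : a m < c.
  by rewrite lt_neqAle mc andbT; apply: contraTneq z0 => mc'; rewrite -Nc -mc' tm0 ltxx.
have ac u : u \in e -> a u < c by move=> ue; apply: le_lt_trans mc; exact: am.
exists c => //.
have T0 l : c <= l -> 0 < \prod_(u in L) t u l.
  move=> cl; apply: prodr_gt0 => u uL; apply: expansive_gt0 (H u (Le u uL)) _.
  by apply: lt_le_trans cl; rewrite ac ?Le.
split.
- by rewrite -Nc mulfK ?subrr // gt_eqF ?T0.
- move=> l k cl lk; have ck := le_trans cl lk.
  have [_ /(_ l k) tv _] := H v ve.
  have : k - l <= t v k - t v l by apply: tv => //; apply: le_trans cl; rewrite ltW ?ac.
  suff : z / \prod_(u in L) t u k <= z / \prod_(u in L) t u l by lra.
  rewrite ler_pM2l // lef_pV2 ?posrE ?T0 //; apply: ler_prod => u uL.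
  have al : a u < l by apply: lt_le_trans cl; rewrite ac ?Le.
  rewrite ltW ?(expansive_gt0 (H u (Le u uL))) //=.
  by have [_ /(_ l k (ltW al) lk) tu _] := H u (Le u uL); lra.
- exists N, ((pq v).2 * \prod_(u in L) (pq u).1) => l cl.
  have ml : a m <= l by apply: le_trans cl; exact: ltW.
  rewrite NE // !(hornerD, hornerN, hornerZ, hornerM) !horner_prod PE //; split; first by rewrite !mulr_gt0 ?q0 ?T0 ?Q0.
  by field; rewrite !gt_eqF ?q0 ?T0 ?Q0.
Qed.

Lemma rmorph_matching_sum (K K' : comNzRingType) (f : {rmorphism K -> K'}) (U : finType)
    (V : {set U}) E (z : {set U} -> K) (s : U -> K) :
  f (matching_sum V E z s) = matching_sum V E (f \o z) (f \o s).
Proof.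
rewrite rmorph_sum; apply: eq_bigr => M _; rewrite rmorphM !rmorph_prod.
by congr (_ * _); apply: eq_bigr => e _ /=; rewrite ?rmorphN.
Qed.

(** Here [t v] stands for [l - w v], possibly pruned, and [s v] for the complex factor at an
    eigenvalue of modulus [l]. Pruning keeps [t v l] below the modulus of [s v], by the triangle
    inequality. The zero of the function left at the last vertex is [rho]. *)
Lemma perron_root (R : rcfType) (U : finType) n (V : {set U}) E
    (w : {set U} -> R[i]) (z : {set U} -> R) (t : U -> R -> R) (a : U -> R) :
  (0 < n)%N -> built n V E ->
  (forall e, e \in E -> 0 < z e /\ w e ^+ n.+1 = (z e)%:C%C) ->
  (forall v, v \in V -> expansive_from (t v) (a v)) ->
  exists rho, [/\ forall v, v \in V -> a v <= rho,
    matching_sum V E z (fun v => t v rho) = 0 &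
    forall l (s x : U -> R[i]), rho < l ->
      (forall v, v \in V -> (t v l)%:C%C <= `|s v|) ->
      eigenvector_on n V E w s x -> forall v, v \in V -> x v = 0].
Proof.
move=> n0 bVE; elim: bVE t a => [r|{}V {}E v L bVE IH vV dVL cL] t a wz Ht.
  have Hr := Ht r (set11 r); exists (a r); split=> [v /set1P->//||l s x al ts].
    by rewrite matching_sum_edgeless big_set1; case: Hr.
  move=> Hx _ /set1P->; have /eqP := Hx r (set11 r).
  rewrite big1 => [|e]; last by rewrite inE.
  rewrite mulf_eq0 expf_eq0 => /orP[/eqP sr|/andP[_ /eqP//]].
  have := ts r (set11 r); rewrite sr normr0 lecR leNgt.
  by rewrite (expansive_gt0 Hr).
set e := v |: L; have vL : v \notin L by rewrite (disjointFr dVL vV).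
have [z0 weE] : 0 < z e /\ w e ^+ n.+1 = (z e)%:C%C by apply: wz; rewrite setU11.
have we0 : w e != 0.
  by apply: contraTneq z0 => we; have := weE; rewrite we expr0n => -[<-]; rewrite ltxx.
have eV u : u \in e -> u \in L :|: V by rewrite !inE => /orP[/eqP->|->] //; rewrite vV orbT.
have VV u : u \in V -> u \in L :|: V by rewrite !inE orbC => ->.
have [c ac Hc] := expansive_pendant vL z0 (fun u ue => Ht u (eV u ue)).
pose t' u l := if u == v then t u l - z e / \prod_(u in L) t u l else t u l.
pose a' u := if u == v then c else a u.
have [|u uV|rho [arho Prho Hrho]] := IH t' a'.
- by move=> f fE; apply: wz; rewrite inE fE orbT.
- rewrite /t' /a'; case: eqP => [->//|_]; exact: Ht (VV u uV).
have crho : c <= rho by have := arho v vV; rewrite /a' eqxx.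
have tL l u : rho <= l -> u \in L -> 0 < t u l.
  move=> rl uL; have ue : u \in e by rewrite in_setU1 uL orbT.
  apply: (expansive_gt0 (Ht u (eV u ue))); apply: lt_le_trans rl.
  by apply: lt_le_trans crho; exact: ac.
exists rho; split.
- move=> u; rewrite inE => /orP[uL|uV].
    by apply: le_trans crho; rewrite ltW // ac // in_setU1 uL orbT.
  have := arho u uV; rewrite /a'; case: eqP => // -> _.
  by apply: le_trans crho; rewrite ltW // ac // setU11.
- rewrite (matching_sum_pendant _ n0 bVE vV dVL cL) -/e; last first.
    by apply/prodf_neq0 => u uL; rewrite gt_eqF ?tL.
  apply/eqP; rewrite mulf_eq0 -Prho; apply/orP; right; apply/eqP.
  by apply: eq_bigr => M _; congr (_ * _); apply: eq_bigr => u _; rewrite /shift_at /t'.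
move=> l s x rl ts Hx.
have s0 u : u \in L -> s u != 0.
  move=> uL; rewrite -normr_gt0; apply: lt_le_trans (ts u _); last by rewrite inE uL.
  by rewrite ltcR tL // ltW.
have [HL _] := (eigenvector_on_pendant w s x n0 bVE vV dVL cL).1 Hx.
have t't u : t' u l <= t u l.
  rewrite /t'; case: eqP => // ->; rewrite gerBl divr_ge0 ?ltW // prodr_gt0 // => u' u'L.
  by rewrite tL // ltW.
have xV : forall u, u \in V -> x u = 0.
  (* If no shift occurs, the bound for [t'] follows from the one for [t] because [t' <= t]. *)
  have [Hx'|[_ Hx']] := eigenvector_on_prune n0 bVE vV dVL cL we0 s0 Hx; last first.
    apply: (Hrho _ _ _ rl _ Hx') => u uV; apply: le_trans (ts u (VV u uV)); by rewrite lecR.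
  apply: (Hrho _ _ _ rl _ Hx') => u uV; rewrite /shift_at /t'; case: eqP => [->|_]; last first.
    exact: ts (VV u uV).
  rewrite -/e weE.
  (* The modulus of [s v] is at least [t v l], and that of the subtracted quotient is at most the
     real one, as its denominator is larger in modulus. *)
  apply: le_trans (lerB_dist _ _); rewrite normf_div normr_prod rmorphB /=.
  apply: lerB; first exact: ts (VV v vV).
  have -> : `|(z e)%:C%C| = (z e)%:C%C by apply: ger0_norm; rewrite ler0c ltW.
  rewrite rmorphM fmorphV rmorph_prod /= ler_pM2l ?ltcR //.
  rewrite lef_pV2 ?posrE; last 2 first.
  - by apply: prodr_gt0 => u' u'L; rewrite normr_gt0 s0.
  - by apply: prodr_gt0 => u' u'L; have := tL l u' (ltW rl) u'L; rewrite -ltcR.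
  apply: ler_prod => u' u'L; rewrite ler0c ltW ?tL ?(ltW rl) //=.
  by apply: ts; rewrite inE u'L.
move=> u; rewrite inE => /orP[uL|/xV//]; apply/eqP.
have /eqP := HL u uL; rewrite (xV v vV) mul0r mulr0 mulf_eq0 (negPf (s0 u uL)) /=.
by rewrite expf_eq0 => /andP[].
Qed.

(** * Connectivity, acyclicity and the construction of k-trees *)

(** Walks are handled through [connect] of this relation, which makes sense for any subset of the
    edges. *)
Definition adjacent (U : finType) (E : {set {set U}}) : rel U :=
  fun u v => [exists e in E, (u \in e) && (v \in e)].

Section Trees.
Variables (U : finType) (k : nat).
Implicit Types (V : {set U}) (E : {set {set U}}) (H : kgraph k U).

Lemma adjacentP E u v :
  reflect (exists2 e, e \in E & (u \in e) && (v \in e)) (adjacent E u v).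
Proof. exact: exists_inP. Qed.

Lemma adjacent_connect_sym E : connect_sym (adjacent E).
Proof.
by apply: sym_connect_sym => u v; apply: eq_existsb => e; rewrite [in RHS](andbC (v \in e)).
Qed.

Lemma connect_adjacentS E E' u v : E \subset E' ->
  connect (adjacent E) u v -> connect (adjacent E') u v.
Proof.
move=> EE'; apply: connect_sub => {u v} u v /adjacentP[e eE uv].
by apply/connect1/adjacentP; exists e; rewrite // (subsetP EE').
Qed.

Lemma walk_connect H u p : is_walk H u p ->
  connect (adjacent (edges H)) u (walk_end u p).
Proof.
rewrite /walk_end; elim: p u => [|[e v] p IH] u //= /and4P[eH ue ve /IH].
by apply: connect_trans; apply/connect1/adjacentP; exists e; rewrite ?ue.
Qed.

(** Each new step is put in front of a simple walk, and any repetition it creates is cut out. The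
    repetition-free walk is what can be closed into a cycle. *)
Lemma connect_simple_walk H E u v : E \subset edges H -> u \in vertices H ->
  connect (adjacent E) u v ->
  exists p, [/\ is_walk H u p, walk_end u p = v, {subset unzip1 p <= E},
    uniq (u :: unzip2 p) & uniq (unzip1 p)].
Proof.
move=> EH uH /connectP[q]; elim: q u uH => [|u' q IH] u uH /= => [_ ->|].
  by exists [::].
case/andP => /adjacentP[e eE /andP[ue u'e]] Hq vE.
have eH := subsetP EH _ eE.
have u'H : u' \in vertices H by apply: subsetP u'e; exact: edge_sub.
have [p [Wp Ep Sp Vp Fp]] := IH u' u'H Hq vE.
have walk_cat x p1 p2 : is_walk H x (p1 ++ p2) -> is_walk H (walk_end x p1) p2.
  by elim: p1 x => //= -[f y] p1 IHp x /= /and4P[_ _ _ /IHp].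
have [uu'|uu'] := eqVneq u u'; first by rewrite uu'; exists p.
(* If [u] is visited again, only the part of the walk after that visit is kept. *)
have [up|up] := boolP (u \in unzip2 p).
  have [[f u0] fp /= uE] := mapP up.
  case/splitPr: fp Wp Ep Sp Vp Fp => p1 p2.
  rewrite /walk_end /unzip1 /unzip2 -cat_rcons !map_cat map_rcons last_cat last_rcons -uE.
  move=> /walk_cat; rewrite /walk_end /unzip2 map_rcons last_rcons.
  move=> Wp Ep Sp; rewrite /= mem_cat negb_or cat_uniq => /andP[_ /and3P[_ D Vp]].
  rewrite cat_uniq => /and3P[_ _ Fp]; exists p2; split=> //.
    by move=> g gp; apply: Sp; rewrite mem_cat gp orbT.
  rewrite /= Vp andbT; apply/negP => up2; move/hasPn: D => /(_ u up2).
  by rewrite mem_rcons inE eqxx.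
(* If [e] is used again, [u] is joined through [e] directly to the end of that later step. *)
have [ep|ep] := boolP (e \in unzip1 p).
  have [[f y] fp /= eE'] := mapP ep.
  case/splitPr: fp Wp Ep Sp Vp Fp up => p1 p2; rewrite -eE' => {eE' f}.
  rewrite /walk_end /unzip1 /unzip2 !map_cat last_cat /=.
  move=> /walk_cat /= /and4P[_ _ ye Wp] Ep Sp; rewrite mem_cat negb_or.
  rewrite cat_uniq /= => /andP[_ /and3P[_ _ Vp]].
  rewrite cat_uniq /= => /and3P[_ _ Fp].
  rewrite mem_cat negb_or => /andP[_ up]; exists ((e, y) :: p2); split=> //=.
  - by rewrite eH ue ye.
  - by move=> g gp; apply: Sp; rewrite mem_cat gp orbT.
  - by rewrite up Vp.
exists ((e, u') :: p); split=> //=.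
- by rewrite eH ue u'e.
- by move=> g; rewrite inE => /predU1P[->|/Sp].
- by move: Vp; rewrite /= inE negb_or uu' up.
- by rewrite ep.
Qed.

(** Otherwise [e], which is outside [E], closes a simple walk in [E] from [u] to [v] into a
    cycle. *)
Lemma acyclic_edge_meet H E u v e : (forall v0 p, ~~ is_cycle H v0 p) ->
  E \subset edges H -> e \in edges H -> e \notin E -> u \in e -> v \in e ->
  connect (adjacent E) u v -> u = v.
Proof.
move=> acyc EH eH eE ue ve uv; apply/eqP; apply: contraT => nuv.
have vH : v \in vertices H by apply: subsetP ve; exact: edge_sub.
have uH : u \in vertices H by apply: subsetP ue; exact: edge_sub.
have [p [Wp Ep Sp Vp Fp]] := connect_simple_walk EH uH uv.
have := acyc v ((e, u) :: p); rewrite /is_cycle /= eH ve ue Wp /=.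
rewrite /walk_end /= in Ep *; rewrite Ep eqxx Fp /= andbT.
have -> : e \notin unzip1 p by apply: contra eE => /Sp.
case: p {Wp Sp Fp} Ep Vp => [/= uv'|? ? _]; first by rewrite uv' eqxx in nuv.
by rewrite /= => ->.
Qed.

Lemma built_connect n V E u v : built n V E -> u \in V -> v \in V ->
  connect (adjacent E) u v.
Proof.
move=> bVE uV vV; move: (bVE) => bVE0.
suff [r Hr] : exists r, forall u, u \in V -> connect (adjacent E) u r.
  by apply: connect_trans (Hr u uV) _; rewrite adjacent_connect_sym Hr.
elim: bVE {u v uV vV bVE0} => [r|{}V {}E v L bVE [r Hr] vV dVL cL].
  by exists r => u /set1P->.
exists r => u; rewrite inE => /orP[uL|uV].
  apply: (connect_trans (y := v)).
    by apply/connect1/adjacentP; exists (v |: L); rewrite ?setU11 //= in_setU1 uL orbT.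
  by apply: connect_adjacentS (subsetUr _ _) _; exact: Hr.
by apply: connect_adjacentS (subsetUr _ _) _; exact: Hr.
Qed.

Lemma connect_exit E V u v : connect (adjacent E) u v -> u \in V -> v \notin V ->
  exists e, [/\ e \in E, ~~ (e \subset V) & exists2 y, y \in e & y \in V].
Proof.
case/connectP => q; elim: q u => [|y q IH] u /= => [_ -> ->//|].
case/andP => /adjacentP[e eE /andP[ue ye]] Hq vE uV vV.
have [yV|yV] := boolP (y \in V); first exact: IH Hq vE yV vV.
by exists e; split=> //; [apply/subsetPn; exists y | exists u].
Qed.

(** A built part grows from a single vertex: connectedness supplies an edge leaving [V], and by
    acyclicity this edge meets [V] in one vertex, so it is pendant. The bound [m] on the number of
    missing vertices drives the induction. *)
Lemma ktree_built n H : k = n.+1 -> (0 < n)%N -> is_ktree H -> vertices H != set0 ->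
  built n (vertices H) (edges H).
Proof.
move=> kE n0 [conH acH] /set0Pn[r rH].
have conn u v : u \in vertices H -> v \in vertices H -> connect (adjacent (edges H)) u v.
  by move=> uH vH; have [p [Wp <-]] := conH u v uH vH; exact: walk_connect.
have cE e : e \in edges H -> #|e| = n.+1 by move=> eH; rewrite (edge_card eH).
(* Once all vertices are reached no edge is missing, since two of its vertices would already be
   joined in [E]. *)
have full E : built n (vertices H) E -> E \subset edges H -> E = edges H.
  move=> bE EH; apply/eqP; rewrite eqEsubset EH; apply/subsetP => e eH; apply: contraT => eE.
  have /card_gt1P[x [y [xe ye]]] : (1 < #|e|)%N by rewrite cE.
  have /subsetP eV := edge_sub eH.
  by rewrite (acyclic_edge_meet acH EH eH eE xe ye) ?eqxx // (built_connect bE) ?eV.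
suff grow m V E : built n V E -> V \subset vertices H -> E \subset edges H ->
    (#|vertices H :\: V| <= m)%N -> built n (vertices H) (edges H).
  by apply: (grow _ [set r] set0 (built_vertex n r)); rewrite ?sub0set ?sub1set.
elim: m V E => [|m IH] V E bVE VH EH cm.
  have VE : V = vertices H.
    by apply/eqP; rewrite eqEsubset VH -setD_eq0 -cards_eq0 -leqn0.
  by rewrite VE in bVE; rewrite -(full E).
have [VE|/subsetPn[v vH vV]] := boolP (vertices H \subset V).
  have VE' : V = vertices H by apply/eqP; rewrite eqEsubset VH.
  by rewrite VE' in bVE; rewrite -(full E).
have [u uV] : exists u, u \in V.
  elim: bVE => [x|? ? ? ? _ [x xV] _ _ _]; exists x; first by rewrite set11.
  by rewrite inE xV orbT.
have [e [eH eV [y ye yV]]] := connect_exit (conn u v (subsetP VH _ uV) vH) uV vV.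
have eE : e \notin E by apply: contra eV => /(built_edge_sub bVE).
have dVL : [disjoint V & e :\ y].
  apply/pred0P => x; rewrite !inE; apply/negP => /and3P[xV xy xe].
  by rewrite (acyclic_edge_meet acH EH eH eE xe ye (built_connect bVE xV yV)) eqxx in xy.
have cL : #|e :\ y| = n by have := cE e eH; rewrite (cardsD1 y) ye => -[].
have := built_pendant bVE yV dVL cL; rewrite setD1K // => bVE'.
apply: IH bVE' _ _ _.
- by rewrite subUset VH andbT; apply: subset_trans (subsetDl _ _) (edge_sub eH).
- by rewrite subUset sub1set eH.
rewrite -ltnS; apply: leq_trans cm; apply: proper_card; apply/properP; split.
  by apply: setDS; exact: subsetUr.
have [x xe xV] := subsetPn eV; exists x.
  by rewrite inE xV (subsetP (edge_sub eH)).
rewrite !inE xe andbT (_ : x != y) //; by apply: contraNneq xV => ->.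
Qed.
End Trees.

(** * From the tensor to eigenvector equations *)

Lemma tensor_apply_cons (K : pzRingType) n N (A : tensor K n.+1 N) (x : 'cV[K]_N) i :
  tensor_apply A x i = \sum_(t : n.-tuple 'I_N) A (cons_tuple i t) * \prod_(j <- t) x j 0.
Proof.
rewrite /tensor_apply (reindex_onto (cons_tuple i) (fun t : n.+1.-tuple 'I_N => behead_tuple t)) /=.
  apply: eq_bigl => t; rewrite eqxx /=; apply/eqP; exact: val_inj.
by case=> -[|j s] // js /eqP[<-]; apply: val_inj.
Qed.

(** A tuple of length [n] with [n] distinct values is an ordering of [A]; there are [n]! of these
    and they all contribute the same product. *)
Lemma sum_tuple_set (K : numFieldType) (U : finType) n (A : {set U}) (c : K) (y : U -> K) :
  #|A| = n ->
  \sum_(t : n.-tuple U | [set j in tval t] == A) c / n`!%:R * \prod_(j <- t) y j =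
  c * \prod_(u in A) y u.
Proof.
move=> cA.
rewrite (eq_bigl (fun t => t \in [set t : n.-tuple U | all [in A] t & uniq t])); last first.
  move=> t; rewrite inE; apply/eqP/andP => [tA|[/allP tA ut]].
    split; first by apply/allP => u; rewrite -tA inE.
    by apply/card_uniqP; rewrite size_tuple -[RHS]cA -tA; apply: eq_card => u; rewrite inE.
  apply/eqP; rewrite eqEcard cA cardsE (card_uniqP ut) size_tuple leqnn andbT.
  by apply/subsetP => u; rewrite inE => /tA.
rewrite (eq_bigr (fun _ : n.-tuple U => c / n`!%:R * \prod_(u in A) y u)) => [|t]; last first.
  rewrite inE => /andP[/allP tA ut]; congr (_ * _).
  rewrite -big_enum; apply: perm_big; apply: uniq_perm => //; first exact: enum_uniq.
  have tE : [set j in tval t] = A.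
    apply/eqP; rewrite eqEcard cA cardsE (card_uniqP ut) size_tuple leqnn andbT.
    by apply/subsetP => u; rewrite inE => /tA.
  by move=> u; rewrite mem_enum -tE inE.
rewrite sumr_const card_uniq_tuples cA ffactnn -mulr_natr.
have : n`!%:R != 0 :> K by rewrite pnatr_eq0 -lt0n fact_gt0.
by move=> ?; field.
Qed.

Section Tensor.
Variables (K : numFieldType) (U : finType) (n : nat) (H : kgraph n.+1 U) (w : weighting U K).
Hypothesis n1 : (0 < n)%N.

Lemma adjacency_tensor_apply (x : U -> K) (i : 'I_#|vertices H|) :
  tensor_apply (adjacency_tensor H w) (\col_j x (enum_val j)) i =
  w (inl (enum_val i)) * x (enum_val i) ^+ n +
  \sum_(e in edges H | enum_val i \in e)
     w (inr e) * \prod_(u in e :\ enum_val i) x u.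
Proof.
set v := enum_val i; rewrite tensor_apply_cons.
rewrite (bigID (fun t : n.-tuple 'I_#|vertices H| => all (pred1 i) t)) /=; congr (_ + _).
  rewrite (big_pred1 [tuple of nseq n i]) => [|t] /=.
    by rewrite /adjacency_tensor /= all_nseq /= eqxx orbT big_nseq iter_mulr_1 mxE.
  apply/idP/eqP => [/all_pred1P|->]; last by rewrite /= all_nseq /= eqxx orbT.
  by rewrite size_tuple => ti; apply: val_inj.
pose im (t : n.-tuple 'I_#|vertices H|) : {set U} := [set enum_val j | j in tval t].
rewrite (eq_bigr (fun t => if v |: im t \in edges H then w (inr (v |: im t)) / n`!%:R * \prod_(j <- t) x (enum_val j) else 0)); last first.
  move=> t ti; rewrite /adjacency_tensor /= (negPf ti).
  have -> : [set enum_val j | j in i :: tval t] = v |: im t.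
    apply/setP => u; apply/imsetP/setU1P => [[j]|[->|/imsetP[j jt ->]]].
    - by rewrite inE => /predU1P[->|jt] ->; [left|right; apply: imset_f].
    - by exists i; rewrite ?mem_head.
    - by exists j; rewrite // inE jt orbT.
  case: ifP => _; last by rewrite mul0r.
  by congr (_ * _); apply: eq_bigr => j _; rewrite mxE.
rewrite -big_mkcondr /=.
(* The nonconstant index tuples are grouped by the edge that they span together with [v]. *)
rewrite (partition_big (fun t => v |: im t) (fun e => (e \in edges H) && (v \in e))) /=; last first.
  by move=> t /andP[_ ->]; rewrite setU11.
apply: eq_bigr => e /andP[eH ve].
have cev : #|e :\ v| = n by have := edge_card eH; rewrite (cardsD1 v) ve => -[].
pose A := [set j : 'I_#|vertices H| | enum_val j \in e :\ v].
have AE : e :\ v = [set enum_val j | j in A].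
  apply/setP => u; apply/idP/imsetP => [ue|[j jA ->]]; last by rewrite in_set in jA.
  have uV : u \in vertices H by apply: (subsetP (edge_sub eH)); case/setD1P: ue.
  exists (enum_rank_in uV u); last by rewrite enum_rankK_in.
  by rewrite in_set enum_rankK_in.
have cA : #|A| = n by rewrite -[RHS]cev AE card_imset //; exact: enum_val_inj.
have imE (t : n.-tuple 'I_#|vertices H|) : im t = [set enum_val j | j in [set j in tval t]].
  apply/setP => u; apply/imsetP/imsetP => -[j jt ->]; exists j => //; first by rewrite inE.
  by rewrite inE in jt.
rewrite (eq_bigl (fun t : n.-tuple _ => [set j in tval t] == A)) => [|t].
  rewrite (eq_bigr (fun t : n.-tuple _ => w (inr e) / n`!%:R * \prod_(j <- t) x (enum_val j))).
    rewrite (sum_tuple_set _ _ cA); congr (_ * _).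
    by rewrite AE big_imset //= => j j' _ _; exact: enum_val_inj.
  by move=> t /eqP tA; rewrite imE tA -AE setD1K.
apply/andP/eqP => [[/andP[_ _] /eqP te]|tA].
  (* The [n] entries must cover the [n] other vertices of [e], so none of them can be [v]. *)
  have vt : v \notin im t.
    apply/negP => vt; have := edge_card eH; rewrite -te (setUidPr _) ?sub1set // => ct.
    have : (#|im t| <= n)%N; last by rewrite ct ltnn.
    apply: leq_trans (leq_imset_card _ _) _.
    by rewrite -[X in (_ <= X)%N](size_tuple t); exact: card_size.
  apply/setP => j; rewrite [RHS]inE -te setU1K // imE mem_imset //; exact: enum_val_inj.
rewrite imE tA -AE setD1K // eqxx eH andbT; split=> //.
have /card_gt0P[j jA] : (0 < #|A|)%N by rewrite cA.
apply/allPn; exists j; first by rewrite -tA inE in jA.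
by move: jA; rewrite in_set => /setD1P[+ _]; apply: contraNN => /eqP->; rewrite eqxx.
Qed.

Lemma adjacency_tensor_eigenvalueP (lambda : K) :
  tensor_eigenvalue (adjacency_tensor H w) lambda <->
  exists2 x : U -> K,
    eigenvector_on n (vertices H) (edges H) (fun e => w (inr e))
      (fun v => lambda - w (inl v)) x &
    exists2 v, v \in vertices H & x v != 0.
Proof.
split=> [[x x0 Hx]|[x Hx [v vV xv]]].
  (* The sum has at most one term; it is zero outside the vertex set. *)
  pose X u := \sum_(j : 'I_#|vertices H| | enum_val j == u) x j 0.
  have XE j : X (enum_val j) = x j 0.
    by rewrite /X (big_pred1 j) // => j' /=; rewrite (inj_eq enum_val_inj).
  have xE : x = \col_j X (enum_val j) by apply/colP => j; rewrite mxE XE.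
  exists X => [v vV|].
    have := Hx (enum_rank_in vV v); rewrite xE adjacency_tensor_apply mxE.
    rewrite enum_rankK_in // => Hv.
    by rewrite mulrBl -Hv addrAC subrr add0r.
  have [j xj|x0'] := pickP (fun j => x j 0 != 0).
    by exists (enum_val j); rewrite ?XE ?enum_valP.
  by case/eqP: x0; apply/colP => j; rewrite mxE; have /negbFE/eqP := x0' j.
exists (\col_j x (enum_val j)).
  apply: contraNneq xv => /colP/(_ (enum_rank_in vV v)); rewrite !mxE enum_rankK_in // => ->.
  by [].
move=> i; rewrite adjacency_tensor_apply mxE -Hx ?enum_valP //=; ring.
Qed.

Lemma horner_matching_poly (lambda : K) :
  (matching_poly H w).[lambda] =
  matching_sum (vertices H) (edges H) (fun e => w (inr e) ^+ n.+1)
    (fun v => lambda - w (inl v)).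
Proof.
rewrite /matching_poly horner_sum; apply: eq_bigr => M _.
rewrite hornerZ horner_prod prodrN; congr (_ * _).
by apply: eq_bigr => v _; rewrite hornerXsubC.
Qed.
End Tensor.

Lemma eq_matching_sum (K : comNzRingType) (U : finType) (V : {set U})
    (E : {set {set U}}) (z z' : {set U} -> K) (s s' : U -> K) :
  {in E, z =1 z'} -> {in V, s =1 s'} ->
  matching_sum V E z s = matching_sum V E z' s'.
Proof.
move=> zz' ss'; apply: eq_bigr => M /andP[/subsetP ME _].
congr (_ * _); first by apply: eq_bigr => e /ME eE; rewrite zz'.
by apply: eq_bigr => v /setDP[vV _]; rewrite ss'.
Qed.

(** * Extension from subtrees and restriction to the support *)

Section Subtrees.
Variables (K : fieldType) (U : finType) (n : nat).
Implicit Types T H : kgraph n.+1 U.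

Lemma is_walkS T H v p : vertices H \subset vertices T -> edges H \subset edges T ->
  is_walk H v p -> is_walk T v p.
Proof.
move=> /subsetP HV /subsetP HE; elim: p v => [|[e u] p IH] v /=; first exact: HV.
by case/and4P => /HE-> -> -> /IH.
Qed.

Lemma acyclicS T H : vertices H \subset vertices T -> edges H \subset edges T ->
  (forall v p, ~~ is_cycle T v p) -> forall v p, ~~ is_cycle H v p.
Proof.
move=> HV HE acT v p; apply: contra (acT v p) => /and5P[Wp *].
by apply/and5P; split=> //; exact: is_walkS Wp.
Qed.

(** An edge of [T] outside [H] meets [H] in at most one vertex. Removing one vertex leaves at least
    two, so a zero entry remains in each product over such an edge. *)
Lemma eigenvector_on_extend T H (w : {set U} -> K) (s x : U -> K) :
  (1 < n)%N -> is_ktree T -> is_subtree H T ->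
  eigenvector_on n (vertices H) (edges H) w s x ->
  eigenvector_on n (vertices T) (edges T) w s
    (fun u => if u \in vertices H then x u else 0).
Proof.
move=> n1 [_ acT] [HV HE [conH _]] Hx v vT.
have conn u u' : u \in vertices H -> u' \in vertices H -> connect (adjacent (edges H)) u u'.
  by move=> uH u'H; have [p [Wp <-]] := conH u u' uH u'H; exact: walk_connect.
have out e : e \in edges T -> e \notin edges H -> v \in e ->
    exists2 u, u \in e :\ v & u \notin vertices H.
  move=> eT eH ve.
  have cev : #|e :\ v| = n by have := edge_card eT; rewrite (cardsD1 v) ve => -[].
  have /card_gt1P[y [y' [ye ye' yy']]] : (1 < #|e :\ v|)%N by rewrite cev.
  have [yH|] := boolP (y \in vertices H); last by exists y.
  have [y'H|] := boolP (y' \in vertices H); last by exists y'.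
  have ye1 : y \in e by case/setD1P: ye.
  have ye1' : y' \in e by case/setD1P: ye'.
  by rewrite (acyclic_edge_meet acT HE eT eH ye1 ye1' (conn _ _ yH y'H)) eqxx in yy'.
have zero e : e \in edges T -> e \notin edges H -> v \in e ->
    w e * \prod_(u in e :\ v) (if u \in vertices H then x u else 0) = 0.
  move=> eT eH ve; have [u ue uH] := out e eT eH ve.
  by rewrite (big_setD1 u ue) /= (negPf uH) mul0r mulr0.
case: ifP => [vH|/negbT vH]; last first.
  rewrite expr0n gtn_eqF ?(ltnW n1) // mulr0 big1 // => e /andP[eT ve]; apply: zero => //.
  by apply: contra vH => eH; apply: subsetP ve; exact: edge_sub.
rewrite Hx // [RHS](bigID (mem (edges H))) /= [X in _ = _ + X]big1 ?addr0; last first.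
  by move=> e /andP[/andP[eT ve] eH]; exact: zero.
apply: eq_big => [e|e /andP[eH _]].
  rewrite [RHS]andbAC; case: (boolP (e \in edges H)) => [/(subsetP HE) ->|]; by rewrite ?andbF ?andbT.
congr (_ * _); apply: eq_bigr => u /setD1P[_ ue].
by rewrite (subsetP (edge_sub eH)).
Qed.

(** [H] is the component of [r] in the graph of the edges of nonzero weight inside the support of
    [x]. Every other edge at a vertex of [H] contributes 0 there: its weight is zero, or it contains
    a vertex where [x] vanishes. *)
Lemma support_subtree T (w : {set U} -> K) (s x : U -> K) r :
  is_ktree T -> r \in vertices T -> x r != 0 ->
  eigenvector_on n (vertices T) (edges T) w s x ->
  exists H : kgraph n.+1 U, [/\ is_subtree H T, vertices H != set0,
    eigenvector_on n (vertices H) (edges H) w s x,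
    forall e, e \in edges H -> w e != 0 & forall v, v \in vertices H -> x v != 0].
Proof.
move=> [_ acT] rT xr Hx.
pose S := [set v in vertices T | x v != 0].
pose E1 := [set e in edges T | (e \subset S) && (w e != 0)].
pose V := [set v | connect (adjacent E1) r v].
pose E := [set e in E1 | e \subset V].
have rV : r \in V by rewrite inE connect0.
have VS : V \subset S.
  apply/subsetP => v; rewrite inE => rv; apply: contraT => vS.
  have [|e [eE1 eS _]] := connect_exit rv _ vS; first by rewrite inE rT.
  by move: eE1; rewrite inE (negPf eS) andbF.
have VT : V \subset vertices T.
  by apply: subset_trans VS _; apply/subsetP => v; rewrite inE => /andP[].
have E_T e : e \in E -> e \in edges T by rewrite !inE => /andP[/andP[]].
have E_V e : e \in E -> e \subset V by rewrite inE => /andP[].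
pose H := @KGraph n.+1 U V E E_V (fun e eE => edge_card (E_T e eE)).
have E1V e v : e \in E1 -> v \in e -> v \in V -> e \in E.
  move=> eE1 ve vV; rewrite inE eE1; apply/subsetP => u ue.
  rewrite inE in vV; rewrite inE; apply: connect_trans vV _.
  by apply/connect1/adjacentP; exists e; rewrite ?ve.
have HE : edges H \subset edges T by apply/subsetP.
exists H; split => //.
- split=> //; split; last exact: acyclicS acT.
  move=> u v; rewrite /= => uV vV.
  have : connect (adjacent E1) u v.
    by rewrite !inE in uV vV; apply: connect_trans vV; rewrite adjacent_connect_sym.
  case/connectP => q; elim: q u uV => [|y q IH] u uV /=.
    by move=> _ ->; exists [::].
  case/andP => /adjacentP[e eE1 /andP[ue ye]] Hq vE.
  have eE := E1V e u eE1 ue uV; have yV := subsetP (E_V e eE) y ye.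
  have [p [Wp Ep]] := IH y yV Hq vE.
  by exists ((e, y) :: p); rewrite /= eE ue ye.
- by apply/set0Pn; exists r.
- move=> v /= vV; rewrite Hx ?(subsetP VT) //.
  rewrite (bigID (mem E)) /= [X in _ + X]big1 ?addr0.
    apply: eq_bigl => e; rewrite andbAC; case: (boolP (e \in E)) => [/E_T ->|]; by rewrite ?andbF ?andbT.
  move=> e /andP[/andP[eT ve] eE].
  have [->|we] := eqVneq (w e) 0; first by rewrite mul0r.
  have : e \notin E1 by apply: contra eE => eE1; exact: E1V vV.
  rewrite inE eT we andbT /= => /subsetPn[u ue uS].
  have uv : u != v by apply: contraNneq uS => ->; exact: (subsetP VS).
  have uev : u \in e :\ v by rewrite !inE uv.
  rewrite (big_setD1 u uev) /=; move: uS.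
  by rewrite inE (subsetP (edge_sub eT) u ue) negbK => /eqP->; rewrite mul0r mulr0.
- by move=> e; rewrite /= !inE => /andP[/and3P[]].
- by move=> v /(subsetP VS); rewrite inE => /andP[].
Qed.
End Subtrees.

(** * The three assertions on eigenvalues of a k-tree *)

Section Main.
Variables (R : realType) (U : finType) (n : nat) (T : kgraph n.+1 U) (w : weighting U R[i]).
Hypotheses (n1 : (1 < n)%N) (hT : is_ktree T).

Lemma vertex_weight_eigenvalue v : v \in vertices T ->
  tensor_eigenvalue (adjacency_tensor T w) (w (inl v)).
Proof.
move=> vT; apply/adjacency_tensor_eigenvalueP; first exact: ltnW.
exists (fun u => (u == v)%:R); last by exists v; rewrite // eqxx oner_eq0.
apply: indicator_eigenvector => // [e|]; [exact: edge_card|exact: subrr].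
Qed.

Lemma subtree_root_eigenvalue (H : kgraph n.+1 U) lambda :
  is_subtree H T -> root (matching_poly H w) lambda ->
  tensor_eigenvalue (adjacency_tensor T w) lambda.
Proof.
move=> HT; rewrite /root horner_matching_poly => /eqP mu0.
(* The empty graph counts as a subtree, but its matching polynomial is 1 and has no root. *)
have [VH|VH] := eqVneq (vertices H) set0.
  have EH : edges H = set0.
    apply/eqP; apply: contraT => /set0Pn[e eH].
    have := edge_card eH; have := edge_sub eH; rewrite VH subset0 => /eqP->.
    by rewrite cards0.
  by move/eqP: mu0; rewrite EH VH matching_sum_edgeless big_set0 oner_eq0.
have [_ _ ktH] := HT.
have [x Hx [v vH xv]] := exists_eigenvector_on n1 (ktree_built erefl (ltnW n1) ktH VH) mu0.
apply/adjacency_tensor_eigenvalueP; first exact: ltnW.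
exists (fun u => if u \in vertices H then x u else 0); last first.
  by exists v; [case: HT => /subsetP HV _ _; exact: HV | rewrite vH].
exact: eigenvector_on_extend Hx.
Qed.

Lemma eigenvalue_subtree_root lambda :
  tensor_eigenvalue (adjacency_tensor T w) lambda ->
  exists H : kgraph n.+1 U, is_subtree H T /\ root (matching_poly H w) lambda.
Proof.
case/(adjacency_tensor_eigenvalueP _ _ (ltnW n1)) => x Hx [v vT xv].
have [H [HT H0 HxH wH xH]] := support_subtree hT vT xv Hx.
exists H; split=> //; rewrite /root horner_matching_poly.
have [_ _ ktH] := HT.
by rewrite (matching_sum_eq0 (ltnW n1) (ktree_built erefl (ltnW n1) ktH H0) wH xH HxH).
Qed.

(** [perron_root] with [t v l = l - w v] gives a root [rho] of the matching polynomial and bounds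
    all eigenvalues. As [T] is a subtree of itself, its roots are eigenvalues, so the same bound
    holds for them. *)
Lemma nonneg_spectral_radius : vertices T != set0 -> nonneg_weighting T w ->
  exists rho : R[i], is_spectral_radius (adjacency_tensor T w) rho /\
    is_largest_root (matching_poly T w) rho.
Proof.
move=> T0 [wV wE].
have bT := ktree_built erefl (ltnW n1) hT T0.
pose a v := complex.Re (w (inl v)).
have aE v : v \in vertices T -> (a v)%:C%C = w (inl v).
  by move=> vT; rewrite RRe_real // ger0_real // wV.
pose z e := complex.Re (w (inr e) ^+ n.+1).
have zE e : e \in edges T -> 0 < z e /\ w (inr e) ^+ n.+1 = (z e)%:C%C.
  move=> eT; have we0 : 0 < w (inr e) ^+ n.+1 by rewrite exprn_gt0 ?wE.
  have ze : w (inr e) ^+ n.+1 = (z e)%:C%C by rewrite RRe_real // gtr0_real.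
  by split=> //; rewrite ze ltcR in we0.
have [|rho [arho mu0 Hrho]] := perron_root (t := fun v l => l - a v) (a := a) (ltnW n1) bT zE.
  move=> v vT; split; [exact: subrr|by move=> l m _ _; lra|].
  by exists ('X - (a v)%:P), 1 => l _; rewrite hornerXsubC hornerC divr1 ltr01.
have rho0 : 0 <= rho.
  have /set0Pn[v vT] := T0; apply: le_trans (arho v vT).
  by rewrite -ler0c aE // wV.
have root_rho : root (matching_poly T w) rho%:C%C.
  rewrite /root horner_matching_poly.
  rewrite (eq_matching_sum (z' := real_complex R \o z) (s' := real_complex R \o (fun v => rho - a v))).
  - by rewrite -rmorph_matching_sum mu0 rmorph0.
  - by move=> e /zE[_ ->].
  - by move=> v vT; rewrite /= rmorphB /= aE.
have TT : is_subtree T T by split.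
have eig z0 : root (matching_poly T w) z0 -> tensor_eigenvalue (adjacency_tensor T w) z0.
  exact: subtree_root_eigenvalue.
have le_rho lambda : tensor_eigenvalue (adjacency_tensor T w) lambda -> `|lambda| <= rho%:C%C.
  case/(adjacency_tensor_eigenvalueP _ _ (ltnW n1)) => x Hx [v vT xv].
  have rE : (complex.Re `|lambda|)%:C%C = `|lambda| by rewrite RRe_real // normr_real.
  (* An eigenvalue of modulus above [rho] would have only the zero eigenvector, because
     [lambda - w v] has modulus at least that of [lambda] minus [w v]. *)
  rewrite -rE lecR leNgt; apply: contra xv => rl; apply/eqP.
  apply: (Hrho _ _ _ rl _ Hx v vT) => u uT.
  rewrite rmorphB /= aE // rE -[X in _ - X](ger0_norm (wV u uT)); exact: lerB_dist.
exists rho%:C%C; split; split=> //; last by move=> z0 /eig/le_rho.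
by exists rho%:C%C; [exact: eig | rewrite ger0_norm // ler0c].
Qed.
End Main.

Theorem theorem1p2 (R : realType) (U : finType) (k : nat) (hk : (3 <= k)%N)
    (T : kgraph k U) (hT : is_ktree T) (w : weighting U R[i]) :
  (forall v, v \in vertices T ->
     tensor_eigenvalue (adjacency_tensor T w) (w (inl v))) /\
  (forall lambda : R[i],
     (forall v, v \in vertices T -> lambda != w (inl v)) ->
     (tensor_eigenvalue (adjacency_tensor T w) lambda <->
      exists T' : kgraph k U,
        is_subtree T' T /\ root (matching_poly T' w) lambda)) /\
  (vertices T != set0 -> nonneg_weighting T w ->
     exists rho : R[i],
       is_spectral_radius (adjacency_tensor T w) rho /\
       is_largest_root (matching_poly T w) rho).
Proof.
case: k hk T hT => // n n1 T hT; split; first exact: vertex_weight_eigenvalue.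
split; last exact: nonneg_spectral_radius.
move=> lambda _; split; first exact: eigenvalue_subtree_root.
by case=> T' [T'T mu0]; exact: subtree_root_eigenvalue T'T mu0.
Qed.
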